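(* For every $\delta\in[0,1)$ and every $\alpha\in(\delta/3,1/3)$ there exists $\epsilon>0$ with the following property. For all constants $0<c_1\le c_2$ there are $C>0$ and $n_0$ such that for all $n\ge n_0$, every prime $p$ with $c_1n^\alpha\le p\le c_2 n^\alpha$, every integer $\ell\le n+n^\delta$ and every $(\epsilon\log n)$-local function $f:\{0,1\}^\ell\to\{0,1\}^{n+1}$, $$\Delta\big(f(U),\,(X,\mathrm{majmod}_p(X)\oplus\mathrm{parity}(X))\big)\ \ge\ \tfrac12-\tfrac{C}{\log n},$$ where $U$ is uniform on $\{0,1\}^\ell$ and $X$ is uniform on $\{0,1\}^n$.
   Context: For $x\in\{0,1\}^k$ let $|x|=\sum_i x_i$ be its Hamming weight, $\mathrm{parity}(x)=|x|\bmod 2$, and for an odd prime $p$, $\mathrm{majmod}_p(x)=0$ if $(|x|\bmod p)<p/2$ and $\mathrm{majmod}_p(x)=1$ otherwise (here $a\bmod p\in\{0,\dots,p-1\}$). A function $f:\{0,1\}^\ell\to\{0,1\}^m$ is $d$-local if each output bit depends on at most $d$ input bits. For distributions $D_1,D_2$ on $\{0,1\}^m$, the total variation distance is $\Delta(D_1,D_2)=\max_{T\subseteq\{0,1\}^m}|\Pr[D_1\in T]-\Pr[D_2\in T]|$. $(X,g(X))$ denotes the distribution of the concatenation of $X$ with the bit $g(X)$. *)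

(* Defs.v *)
From HB Require Import structures.
From mathcomp Require Import all_boot all_order all_algebra.
From mathcomp Require Import reals exp.
Set Implicit Arguments. Unset Strict Implicit. Unset Printing Implicit Defensive.
Import Order.TTheory GRing.Theory Num.Theory.
Local Open Scope ring_scope.

Notation bits k := {ffun 'I_k -> bool}.

Definition hweight k (x : bits k) : nat := #|[set i | x i]|.
Definition parity k (x : bits k) : bool := odd (hweight x).
(* majmod_p(x) = 0 iff (|x| mod p) < p/2, i.e. 2*(|x| mod p) < p *)
Definition majmod (p : nat) k (x : bits k) : bool := ~~ ((hweight x %% p).*2 < p)%N.

Definition snoc_bit k (x : bits k) (b : bool) : bits k.+1 :=
  [ffun i => if unlift ord_max i is Some j then x j else b].

Definition target_map (p n : nat) (x : bits n) : bits n.+1 :=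
  snoc_bit x (majmod p x (+) parity x).

Definition push_prob (R : realType) (A B : finType) (g : A -> B) (T : {set B}) : R :=
  #|[set a | g a \in T]|%:R / #|A|%:R.

Definition tv_push (R : realType) (A1 A2 B : finType) (g1 : A1 -> B) (g2 : A2 -> B) : R :=
  \big[Num.max/0]_(T : {set B}) `|push_prob R g1 T - push_prob R g2 T|.

Definition is_local (R : realType) (l m : nat) (d : R) (f : bits l -> bits m) : Prop :=
  forall i : 'I_m, exists S : {set 'I_l}, #|S|%:R <= d /\
    forall x y : bits l, (forall j, j \in S -> x j = y j) -> f x i = f y i.

(* Main.v *)
(** If [l < n] the image of [f] is too small. Otherwise pick about [n / d^2] input bits [I] of
    degree at most [4d] whose output blocks are pairwise disjoint and which do not touch the
    last output bit. Once the other inputs are fixed, the weight of the output is a constant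
    plus a sum of independent two-valued terms, one for each [i] in [I].

    If at least [N] of these terms are non-constant, averaging the signed majority over them
    contracts its mean-zero part in L2([F_p]), since the shift by a nonzero residue satisfies a
    Poincare inequality with constant [O(p^2)]; the last output bit is then wrong with
    probability about 1/2. Otherwise, a block of the output that vanishes identically is either
    constant in its own input or has non-constant weight. By Chebyshev a uniform string has at
    least [K] vanishing blocks, so an output of this kind with as many vanishing blocks leaves
    [K - N] inputs without influence: it has at least [2 ^ (K - N)] preimages, and such outputs
    form a negligible set. *)

Require Import Defs.
From mathcomp Require Import all_boot all_order all_algebra.
From mathcomp Require Import ring lra zify.
From mathcomp Require Import reals topology normedtype sequences exp.
Set Implicit Arguments. Unset Strict Implicit. Unset Printing Implicit Defensive.
Import Order.TTheory GRing.Theory Num.Theory.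
Local Open Scope ring_scope.

Lemma natr_card (R : pzSemiRingType) (T : finType) (P : pred T) :
  #|[set x | P x]|%:R = \sum_x (P x)%:R :> R.
Proof. by rewrite -natr_sum -big_mkcond sum1dep_card. Qed.

Lemma sqr_sum_le_card (R : realFieldType) (I : finType) (a : I -> R) :
  (\sum_i a i) ^+ 2 <= #|I|%:R * \sum_i a i ^+ 2.
Proof.
suff -> : #|I|%:R * \sum_i a i ^+ 2 =
    (\sum_i a i) ^+ 2 + (\sum_i \sum_k (a i - a k) ^+ 2) / 2.
  by rewrite lerDl divr_ge0 // !sumr_ge0 // => i _; rewrite sumr_ge0 // => k _; exact: sqr_ge0.
have -> : \sum_i \sum_k (a i - a k) ^+ 2 =
    \sum_i (#|I|%:R * a i ^+ 2 - 2 * a i * \sum_k a k + \sum_k a k ^+ 2).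
  apply: eq_bigr => i _; rewrite mulr_sumr mulr_natl -sumr_const -sumrB -big_split.
  by apply: eq_bigr => k _ /=; ring.
rewrite big_split sumrB /= -mulr_sumr -mulr_suml -mulr_sumr sumr_const -mulr_natl.
by field.
Qed.

Lemma sum_sqr_centered_le (R : realFieldType) (T : finType) (m : T -> R) (c : R) :
  #|T|%:R * c = \sum_v m v -> \sum_v (m v - c) ^+ 2 <= \sum_v m v ^+ 2.
Proof.
move=> cE; suff -> : \sum_v (m v - c) ^+ 2 = \sum_v m v ^+ 2 - #|T|%:R * c ^+ 2.
  by rewrite gerBl mulr_ge0 ?sqr_ge0.
transitivity (\sum_v (m v ^+ 2 - 2 * c * m v + c ^+ 2)); first by apply: eq_bigr => v _; ring.
by rewrite big_split sumrB /= -mulr_sumr -cE sumr_const -mulr_natl; ring.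
Qed.

(** * Shifts of a finite abelian group *)

Section Shifts.
Variables (R : realFieldType) (V : finZmodType).
Implicit Types (m : V -> R) (a v w : V).

Lemma sum_shift m a : \sum_v m (v + a) = \sum_v m v.
Proof. by rewrite [RHS](reindex_inj (addIr a)). Qed.

Lemma twisted_telescope (s : R) m a (k : nat) v :
  m v - s ^+ k * m (v + a *+ k) =
  \sum_(j < k) s ^+ j * (m (v + a *+ j) - s * m (v + a *+ j + a)).
Proof.
elim: k => [|k IHk]; first by rewrite big_ord0 addr0 mul1r subrr.
by rewrite big_ord_recr /= -IHk exprSr mulrSr addrA; ring.
Qed.

Lemma sum_sqr_twisted_shift_le (s : R) m a (k : nat) :
  s ^+ 2 = 1 ->
  \sum_v (m v - s ^+ k * m (v + a *+ k)) ^+ 2 <=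
  k%:R ^+ 2 * \sum_v (m v - s * m (v + a)) ^+ 2.
Proof.
move=> s2; pose step v := (m v - s * m (v + a)) ^+ 2.
have bound v : (m v - s ^+ k * m (v + a *+ k)) ^+ 2 <= k%:R * \sum_(j < k) step (v + a *+ j).
  rewrite twisted_telescope; apply: le_trans (sqr_sum_le_card _) _.
  rewrite card_ord; under eq_bigr do rewrite exprMn -exprM mulnC exprM s2 expr1n mul1r.
  exact: lexx.
apply: le_trans (ler_sum _ (fun v _ => bound v)) _.
rewrite -mulr_sumr exchange_big /=; under eq_bigr do rewrite (sum_shift step).
by rewrite sumr_const card_ord -[X in _ * X]mulr_natl mulrA -expr2.
Qed.

(* Average over all shifts [w = a *+ k] the L2 distance between [m] and its shift by [w], which
   is at most [k] times the one for [a]. *)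
Lemma poincare_generator m a :
  (forall w, exists2 k, (k <= #|V|)%N & w = a *+ k) -> \sum_v m v = 0 ->
  2 * \sum_v m v ^+ 2 <= #|V|%:R ^+ 2 * \sum_v (m v - m (v + a)) ^+ 2.
Proof.
move=> a_gen m0; set E := \sum_v (m v - m (v + a)) ^+ 2.
have V0 : 0 < #|V|%:R :> R by rewrite ltr0n; apply/card_gt0P; exists 0.
have shift_le w : \sum_v (m v - m (v + w)) ^+ 2 <= #|V|%:R ^+ 2 * E.
  have [k kV ->] := a_gen w.
  have := sum_sqr_twisted_shift_le m a k (expr1n R 2).
  under eq_bigr do rewrite expr1n mul1r.
  under [X in _ <= _ * X]eq_bigr do rewrite mul1r.
  move=> /le_trans; apply; rewrite ler_wpM2r ?lerXn2r ?nnegrE ?ler_nat //.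
  by apply: sumr_ge0 => v _; exact: sqr_ge0.
have all_shifts : \sum_w \sum_v (m v - m (v + w)) ^+ 2 = #|V|%:R * (2 * \sum_v m v ^+ 2).
  rewrite exchange_big /=.
  transitivity (\sum_v (#|V|%:R * m v ^+ 2 + \sum_w m w ^+ 2)); last first.
    by rewrite big_split /= -mulr_sumr sumr_const -mulr_natl; ring.
  apply: eq_bigr => v _.
  have shiftE (g : V -> R) : \sum_w g (v + w) = \sum_w g w.
    by rewrite [RHS](reindex_inj (addrI v)).
  transitivity (\sum_w (m v ^+ 2 - 2 * m v * m (v + w) + m (v + w) ^+ 2)).
    by apply: eq_bigr => w _; ring.
  rewrite big_split sumrB /= sumr_const -mulr_sumr (shiftE m) (shiftE (fun w => m w ^+ 2)) m0.
  by rewrite mulr0 subr0 -[X in X + _]mulr_natl.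
rewrite -(ler_pM2l V0) -all_shifts mulr_natl -sumr_const.
exact: ler_sum (fun w _ => shift_le w).
Qed.

(* Going once around the odd cycle generated by [a] turns [m v] into [- m v]. *)
Lemma poincare_odd_order m a (k : nat) :
  odd k -> a *+ k = 0 -> 4 * \sum_v m v ^+ 2 <= k%:R ^+ 2 * \sum_v (m v + m (v + a)) ^+ 2.
Proof.
move=> k_odd ak0; have sign2 : (-1 : R) ^+ 2 = 1 by rewrite sqrrN expr1n.
have := sum_sqr_twisted_shift_le m a k sign2; rewrite -signr_odd k_odd ak0.
under eq_bigr => v _ do rewrite addr0 mulN1r opprK -mulr2n -mulr_natl exprMn -natrX.
under [X in _ <= _ * X]eq_bigr do rewrite mulN1r opprK.
by rewrite -mulr_sumr.
Qed.

End Shifts.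

(** * Signed averages modulo a prime *)

Section SignedAverages.
Variables (R : realFieldType) (p : nat).
Hypotheses (p_pr : prime p) (p_odd : odd p).
Implicit Types (m : 'F_p -> R) (e : int) (es : seq int) (v : 'F_p).

Definition avg_shift e m : 'F_p -> R := fun v => (m v + (-1) ^ e * m (v + e%:~R)) / 2.

Definition avg_shifts m es : 'F_p -> R := foldr avg_shift m es.

Definition shift_contraction : R := 1 - (2 * p%:R ^+ 2)^-1.

Lemma ltn_Fp v : (v < p)%N.
Proof. by have := ltn_ord v; rewrite [X in (_ < X)%N -> _]Fp_cast. Qed.

Lemma Fp_mulrn_surj (a : 'F_p) : a != 0 -> forall w, exists2 k, (k <= #|'F_p|)%N & w = a *+ k.
Proof.
move=> a0 w; exists (val (w / a)); first by rewrite card_Fp // ltnW // ltn_Fp.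
by rewrite -mulr_natl natr_Zp divfK.
Qed.

Lemma poincare_signed_shift m e : \sum_v m v = 0 -> e%:~R != 0 :> 'F_p ->
  2 * \sum_v m v ^+ 2 <= p%:R ^+ 2 * \sum_v (m v - (-1) ^ e * m (v + e%:~R)) ^+ 2.
Proof.
move=> m0 e0; have -> : (-1) ^ e = (-1) ^+ odd `|e| :> R by rewrite signr_odd expN1r.
case: odd.
  under [X in _ <= _ * X]eq_bigr do rewrite mulN1r opprK.
  apply: le_trans (poincare_odd_order _ p_odd (mulrn_pchar (pchar_Fp p_pr) _)).
  by rewrite ler_wpM2r ?ler_nat //; apply: sumr_ge0 => v _; exact: sqr_ge0.
under [X in _ <= _ * X]eq_bigr do rewrite mul1r.
by have := poincare_generator (Fp_mulrn_surj e0) m0; rewrite card_Fp.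
Qed.

Lemma sum_sqr_avg_shift_le e m : \sum_v m v = 0 -> e%:~R != 0 :> 'F_p ->
  \sum_v avg_shift e m v ^+ 2 <= shift_contraction * \sum_v m v ^+ 2.
Proof.
move=> m0 e0; have p2 : 0 < p%:R ^+ 2 :> R by rewrite exprn_gt0 // ltr0n prime_gt0.
set sq := \sum_v m v ^+ 2; pose E := \sum_v (m v - (-1) ^ e * m (v + e%:~R)) ^+ 2.
have -> : \sum_v avg_shift e m v ^+ 2 = sq - E / 4.
  have -> : sq = \sum_v (m v ^+ 2 + m (v + e%:~R) ^+ 2) / 2.
    by rewrite -mulr_suml big_split /= (sum_shift (fun v => m v ^+ 2)) /sq; field.
  rewrite /E mulr_suml -sumrB; apply: eq_bigr => v _; rewrite /avg_shift.
  have : ((-1) ^ e) ^+ 2 = 1 :> R by rewrite expN1r sqrr_sign.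
  by move: ((-1) ^ e) (m v) (m _) => s x y s2; field: s2.
rewrite /shift_contraction mulrBl mul1r lerD2l lerN2 invfM -mulrA.
have := poincare_signed_shift m0 e0; rewrite -/sq -/E -ler_pdivrMl //; lra.
Qed.

Lemma sum_avg_shifts m es : \sum_v m v = 0 -> \sum_v avg_shifts m es v = 0.
Proof.
move=> m0; elim: es => //= e es IHes.
by rewrite -mulr_suml big_split /= -mulr_sumr sum_shift IHes mulr0 addr0 mul0r.
Qed.

Lemma avg_shiftsB m1 m2 es v :
  avg_shifts (fun w => m1 w - m2 w) es v = avg_shifts m1 es v - avg_shifts m2 es v.
Proof. by elim: es v => //= e es IHes v; rewrite /avg_shift !IHes; field. Qed.

Lemma norm_avg_shifts_le m es (c : R) :
  (forall v, `|m v| <= c) -> forall v, `|avg_shifts m es v| <= c.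
Proof.
move=> mc; elim: es => //= e es IHes v.
rewrite normrM normfV (normr_nat _ 2) ler_pdivrMr //.
apply: le_trans (ler_normD _ _) _; rewrite normrM expN1r normrX normrN1 expr1n mul1r.
by rewrite mulr_natr mulr2n lerD.
Qed.

Lemma shift_contraction_ge0 : 0 <= shift_contraction.
Proof.
have p1 : 1 <= p%:R :> R by rewrite ler1n prime_gt0.
by rewrite subr_ge0 invf_le1; nra.
Qed.

Lemma shift_contraction_le1 : shift_contraction <= 1.
Proof. by rewrite gerBl invr_ge0 mulr_ge0 ?sqr_ge0. Qed.

Lemma sum_sqr_avg_shifts_le m es :
  \sum_v m v = 0 -> {in es, forall e, e != 0 -> e%:~R != 0 :> 'F_p} ->
  \sum_v avg_shifts m es v ^+ 2 <= shift_contraction ^+ count (predC1 0) es * \sum_v m v ^+ 2.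
Proof.
move=> m0; elim: es => [|e es IHes] es_p /=; first by rewrite mul1r.
have {}IHes := IHes (sub_in1 (mem_behead (s := e :: es)) es_p).
have [->|e0] /= := eqVneq e 0.
  have avg0 v : avg_shift 0 (avg_shifts m es) v = avg_shifts m es v.
    by rewrite /avg_shift mulr0z addr0 mul1r; field.
  by under eq_bigr do rewrite avg0.
apply: le_trans (sum_sqr_avg_shift_le (sum_avg_shifts es m0) _) _; first by rewrite es_p ?mem_head.
by rewrite exprS -mulrA ler_wpM2l // shift_contraction_ge0.
Qed.

Lemma norm_avg_shifts_le_mean m es (N : nat) (eta : R) v :
  {in es, forall e, e != 0 -> e%:~R != 0 :> 'F_p} -> (N <= count (predC1 0%R) es)%N ->
  0 <= eta -> shift_contraction ^+ N * \sum_w m w ^+ 2 <= eta ^+ 2 ->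
  `|avg_shifts m es v| <= `|\sum_w m w| / p%:R + eta.
Proof.
move=> es_p Nes eta0 eta_m.
have p0 : p%:R != 0 :> R by rewrite pnatr_eq0 -lt0n prime_gt0.
pose c := (\sum_w m w) / p%:R; pose m0 w := m w - c.
have cE : #|'F_p|%:R * c = \sum_w m w by rewrite card_Fp // mulrC divfK.
have m0_sum : \sum_w m0 w = 0 by rewrite sumrB sumr_const -mulr_natl cE subrr.
rewrite -[avg_shifts m es v](subrKC (avg_shifts (fun=> c) es v)) -avg_shiftsB.
apply: le_trans (ler_normD _ _) _; apply: lerD.
  have -> : `|\sum_w m w| / p%:R = `|c| by rewrite normrM normfV normr_nat.
  exact: norm_avg_shifts_le.
rewrite -(@ler_pXn2r _ 2) ?nnegrE // real_normK ?num_real //.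
apply: le_trans eta_m.
apply: (@le_trans _ _ (\sum_w avg_shifts m0 es w ^+ 2)).
  by rewrite (bigD1 v) //= lerDl sumr_ge0 // => w _; exact: sqr_ge0.
apply: le_trans (sum_sqr_avg_shifts_le m0_sum es_p) _.
apply: ler_pM; rewrite ?exprn_ge0 ?shift_contraction_ge0 ?sum_sqr_centered_le //.
  by rewrite sumr_ge0 // => w _; exact: sqr_ge0.
by rewrite ler_wiXn2l ?shift_contraction_ge0 ?shift_contraction_le1.
Qed.

End SignedAverages.

Lemma intr_Fp_neq0 (p : nat) (e : int) :
  prime p -> (`|e| < p)%N -> e != 0 -> e%:~R != 0 :> 'F_p.
Proof.
move=> p_pr ep; rewrite -absz_gt0 => e0.
rewrite [e]intEsign rmorphM rmorph_sign mulf_neq0 ?signr_eq0 //= -pmulrn.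
by apply: contraL e0 => /eqP/(congr1 val); rewrite /= val_Fp_nat // modn_small // => ->.
Qed.

(* On weights, majmod + parity is the function [majmod_sign] of [F_p] twisted by the sign of the
   parity, so that one works modulo [p] rather than modulo [2p]. *)
Definition twist (R : realFieldType) (p : nat) (m : 'F_p -> R) (w : int) : R :=
  (-1) ^ w * m w%:~R.

Definition majmod_sign (R : realFieldType) (p : nat) (v : 'F_p) : R :=
  (-1) ^+ ~~ ((v : nat).*2 < p)%N.
Arguments majmod_sign R p v : clear implicits.

Lemma twist_avg_shift (R : realFieldType) (p : nat) (e : int) (m : 'F_p -> R) (w : int) :
  twist (avg_shift e m) w = (twist m w + twist m (w + e)) / 2.
Proof.
by rewrite /twist /avg_shift expfzDr ?oppr_eq0 ?oner_eq0 // rmorphD /=; field.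
Qed.

Lemma norm_twist (R : realFieldType) (p : nat) (m : 'F_p -> R) (w : int) :
  `|twist m w| = `|m w%:~R|.
Proof. by rewrite normrM expN1r normrX normrN1 expr1n mul1r. Qed.

Lemma twist_majmod_sign (R : realFieldType) (p k : nat) (x : bits k) : prime p ->
  twist (majmod_sign R p) (hweight x) = (-1) ^+ (majmod p x (+) parity x).
Proof.
move=> p_pr; rewrite /twist /majmod_sign /majmod /parity -?pmulrn val_Fp_nat //.
by rewrite expN1r /= -signr_odd -signr_addb addbC.
Qed.

Lemma norm_sum_majmod_sign_le1 (R : realFieldType) (p : nat) : prime p -> odd p ->
  `|\sum_v majmod_sign R p v| <= 1.
Proof.
move=> p_pr p_odd; rewrite (bigD1 0) //=; set nonzero := \sum_(v | _) _.
suff -> : nonzero = 0 by rewrite addr0 normr_sign.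
suff : nonzero = - nonzero by lra.
rewrite {1}/nonzero (reindex_inj oppr_inj) -sumrN; apply: eq_big => v; rewrite oppr_eq0 //.
move=> v0; have v_gt0 : (0 < v)%N by rewrite lt0n; apply: contra v0.
have opp_v : (- v : 'F_p) = (p - v)%N :> nat.
  by rewrite /= ![X in (_ %% X)%N]Fp_cast // [X in (X - _)%N]Fp_cast // modn_small; lia.
have := ltn_Fp p_pr v.
by rewrite /majmod_sign opp_v -signrN negbK => v_lt; congr (_ ^+ _); lia.
Qed.

Section Involutions.
Variables (R : realFieldType) (p : nat) (U : finType) (I : eqType).
Variables (tau : I -> U -> U) (W : U -> int) (c : U -> R).
Hypothesis tauK : forall i, involutive (tau i).

Definition increment (i : I) (u : U) : int := W (tau i u) - W u.

Lemma sum_twist_avg_increments (m : 'F_p -> R) (s : seq I) : uniq s ->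
  {in s, forall i u, c (tau i u) = c u} ->
  {in s &, forall i j, i != j -> forall u, increment j (tau i u) = increment j u} ->
  \sum_u c u * twist m (W u) =
  \sum_u c u * twist (avg_shifts m [seq increment i u | i <- s]) (W u).
Proof.
elim: s => [|i s IHs] //= /andP[i_s s_uniq] c_inv inc_inv.
rewrite IHs //; last 2 first.
- by move=> j js u; apply: c_inv; rewrite inE js orbT.
- by move=> j k js ks; apply: inc_inv; rewrite inE (js, ks) orbT.
pose h u := c u * twist (avg_shifts m [seq increment j u | j <- s]) (W u).
have h_tau : \sum_u h (tau i u) = \sum_u h u.
  by rewrite [RHS](reindex_inj (inv_inj (tauK i))).
transitivity ((\sum_u h u + \sum_u h (tau i u)) / 2); first by rewrite h_tau; field.
rewrite -big_split /= mulr_suml; apply: eq_bigr => u _.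
have incs_tau : [seq increment j (tau i u) | j <- s] = [seq increment j u | j <- s].
  apply/eq_in_map => j js; apply: inc_inv; rewrite ?mem_head ?inE ?js ?orbT //.
  by apply: contraNneq i_s => ->.
rewrite twist_avg_shift /h c_inv ?mem_head // incs_tau /increment subrKC.
by ring.
Qed.

End Involutions.

(** * Vanishing blocks of a uniform string *)

Section Vanishing.
Variables (R : realFieldType) (J : finType).
Implicit Types (C : {set J}) (x : {ffun J -> bool}).

Definition vanishes C x : bool := [forall j in C, ~~ x j].

Definition centered_vanishes C x : R := (vanishes C x)%:R - 2 ^- #|C|.

Lemma card_bool_ffun : #|{: {ffun J -> bool}}| = (2 ^ #|J|)%N.
Proof. by rewrite card_ffun card_bool. Qed.

Lemma sum_vanishes C : \sum_x (vanishes C x)%:R = 2 ^+ #|J| * 2 ^- #|C| :> R.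
Proof.
rewrite -natr_card.
have -> : #|[set x | vanishes C x]| = #|[pred x in pffun_on false (mem (~: C)) predT]|.
  apply: eq_card => x; rewrite !inE; apply/forall_inP/pffun_onP => [xC|[/subsetP xC _] j jC].
    split=> //; apply/subsetP => j; rewrite !inE; apply: contra => /xC.
    by rewrite eqbF_neg.
  by apply: contraL jC => xj; rewrite -in_setC xC // inE xj.
rewrite card_pffun_on card_bool natrX -(cardsC C) exprD mulrAC divff ?mul1r //.
by rewrite expf_neq0 ?pnatr_eq0.
Qed.

Lemma vanishes_setU C1 C2 x : vanishes (C1 :|: C2) x = vanishes C1 x && vanishes C2 x.
Proof.
apply/forall_inP/andP => [xC|[/forall_inP xC1 /forall_inP xC2] j].
  by split; apply/forall_inP => j jC; apply: xC; rewrite inE jC ?orbT.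
by rewrite inE => /orP[/xC1|/xC2].
Qed.

Lemma sum_centered_vanishes_mul C1 C2 :
  \sum_x centered_vanishes C1 x * centered_vanishes C2 x =
  2 ^+ #|J| * (2 ^- #|C1 :|: C2| - 2 ^- #|C1| * 2 ^- #|C2|).
Proof.
set q1 := 2 ^- #|C1|; set q2 := 2 ^- #|C2|.
transitivity (\sum_x ((vanishes (C1 :|: C2) x)%:R - q2 * (vanishes C1 x)%:R
    - q1 * (vanishes C2 x)%:R + q1 * q2)).
  by apply: eq_bigr => x _; rewrite /centered_vanishes vanishes_setU -mulnb natrM -/q1 -/q2; ring.
rewrite big_split !sumrB -!mulr_sumr !sum_vanishes sumr_const card_bool_ffun.
by rewrite -/q1 -/q2 -[_ *+ (2 ^ #|J|)]mulr_natl natrX /=; ring.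
Qed.

Lemma sum_centered_vanishes_disjoint C1 C2 : [disjoint C1 & C2] ->
  \sum_x centered_vanishes C1 x * centered_vanishes C2 x = 0.
Proof.
have [_ + disj] := leq_card_setU C1 C2; rewrite disj => /eqP cardU.
by rewrite sum_centered_vanishes_mul cardU exprD invfM subrr mulr0.
Qed.

Lemma sum_sqr_centered_vanishes_le C :
  \sum_x centered_vanishes C x ^+ 2 <= 2 ^+ #|J| * 2 ^- #|C|.
Proof.
under eq_bigr do rewrite expr2; rewrite sum_centered_vanishes_mul setUid.
by rewrite ler_wpM2l ?exprn_ge0 // gerBl -expr2 sqr_ge0.
Qed.

End Vanishing.

Lemma sum_sqr_orthogonal (R : comPzRingType) (X T : finType) (I : {set T}) (Y : T -> X -> R) :
  {in I &, forall i k, i != k -> \sum_x Y i x * Y k x = 0} ->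
  \sum_x (\sum_(i in I) Y i x) ^+ 2 = \sum_(i in I) \sum_x Y i x ^+ 2.
Proof.
move=> Y_orth; transitivity (\sum_(i in I) \sum_(k in I) \sum_x Y i x * Y k x).
  under [RHS]eq_bigr do rewrite exchange_big /=; rewrite exchange_big.
  apply: eq_bigr => x _; rewrite expr2 mulr_suml.
  by apply: eq_bigr => i _; rewrite mulr_sumr.
apply: eq_bigr => i iI; rewrite (bigD1 i) //= [X in _ + X]big1 ?addr0 // => k /andP[kI ki].
by rewrite Y_orth // eq_sym.
Qed.

Lemma card_lower_half_le (R : realFieldType) (X : finType) (g : X -> R) (E : R) :
  0 < E -> #|[set x | g x < E / 2]|%:R * (E ^+ 2 / 4) <= \sum_x (g x - E) ^+ 2.
Proof.
move=> E0; rewrite natr_card mulr_suml; apply: ler_sum => x _.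
by case: ltrP => [gE|_]; rewrite ?mul0r ?sqr_ge0 // mul1r; nra.
Qed.

Section ZeroBlocks.
Variables (R : realFieldType) (J T : finType) (I : {set T}) (B : T -> {set J}).
Hypothesis B_disj : {in I &, forall i k, i != k -> [disjoint B i & B k]}.

Definition zero_blocks (x : {ffun J -> bool}) : {set T} := [set i in I | vanishes (B i) x].

Definition mean_zero_blocks : R := \sum_(i in I) 2 ^- #|B i|.

Lemma sum_sqr_zero_blocks_le :
  \sum_x (#|zero_blocks x|%:R - mean_zero_blocks) ^+ 2 <= 2 ^+ #|J| * mean_zero_blocks.
Proof.
have centeredE x :
    #|zero_blocks x|%:R - mean_zero_blocks = \sum_(i in I) centered_vanishes R (B i) x.
  rewrite sumrB natr_card [in RHS]big_mkcond; congr (_ - _); apply: eq_bigr => i _.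
  by case: (i \in I).
under eq_bigr do rewrite centeredE.
rewrite sum_sqr_orthogonal => [|i k iI kI ik]; last first.
  by rewrite sum_centered_vanishes_disjoint // B_disj.
by rewrite mulr_sumr; apply: ler_sum => i _; exact: sum_sqr_centered_vanishes_le.
Qed.

Lemma card_few_zero_blocks_le (K : nat) : (0 < K)%N -> K.*2%:R <= mean_zero_blocks ->
  #|[set x | #|zero_blocks x| < K]%N|%:R <= 2 ^+ #|J| * (2 / K%:R) :> R.
Proof.
rewrite -muln2 natrM -(ltr_nat R) => K0; set E := mean_zero_blocks => KE.
have E0 : 0 < E by lra.
have few_le : #|[set x | #|zero_blocks x| < K]%N|%:R <=
    #|[set x | #|zero_blocks x|%:R < E / 2]|%:R :> R.
  rewrite ler_nat; apply/subset_leq_card/subsetP => x; rewrite !inE -(ltr_nat R) => xK.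
  by lra.
apply: le_trans few_le _.
have E2 : 0 < E ^+ 2 / 4 by rewrite divr_gt0 ?exprn_gt0.
rewrite -(ler_pM2r E2); apply: le_trans (card_lower_half_le _ E0) _.
apply: le_trans sum_sqr_zero_blocks_le _.
rewrite -mulrA ler_wpM2l ?exprn_ge0 // -/E.
rewrite mulrAC ler_pdivlMr //; nra.
Qed.

End ZeroBlocks.

(** * Scattered sets of inputs *)

Lemma leq_card_bigcup (I T : finType) (P : pred I) (A : I -> {set T}) :
  (#|\bigcup_(i | P i) A i| <= \sum_(i | P i) #|A i|)%N.
Proof.
elim/big_rec2: _ => [|i k B _ leB]; first by rewrite cards0.
by rewrite (leq_trans (leq_card_setU _ _)) // leq_add2l.
Qed.

Section Scattered.
Variables (J T : finType) (S : J -> {set T}).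
Implicit Types (i k : T) (j : J) (I F G : {set T}).

Definition outputs i : {set J} := [set j | i \in S j].

Definition neighbours i : {set T} := \bigcup_(j in outputs i) S j.

Definition scattered I : bool := [forall j, #|I :&: S j| <= 1]%N.

Lemma scatteredP I :
  reflect (forall j, {in I &, forall i k, i \in S j -> k \in S j -> i = k}) (scattered I).
Proof.
apply: (iffP forallP) => [I1 j i k iI kI ij kj | I1 j].
  by apply: (card_le1_eqP (I1 j)); rewrite inE ?iI ?kI.
by apply/card_le1_eqP => i k /setIP[iI ij] /setIP[kI kj]; apply: I1 kj ij.
Qed.

Lemma sum_card_outputs : (\sum_i #|outputs i| = \sum_j #|S j|)%N.
Proof.
transitivity (\sum_i \sum_j (i \in S j))%N.
  by apply: eq_bigr => i _; rewrite -sum1dep_card big_mkcond.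
rewrite exchange_big /=; apply: eq_bigr => j _.
by rewrite -sum1_card [RHS]big_mkcond.
Qed.

Lemma card_gt_outputs_le (a : nat) :
  (a * #|[set i | a < #|outputs i|]| <= \sum_j #|S j|)%N.
Proof.
rewrite -sum_card_outputs mulnC -sum_nat_const.
rewrite [X in (_ <= X)%N](bigID (mem [set i | a < #|outputs i|]%N)) /=.
by apply: leq_trans (leq_addr _ _); apply: leq_sum => i; rewrite inE; exact: ltnW.
Qed.

(* Take [I] maximal: the other elements of [G] are then neighbours of elements of [I]. *)
Lemma exists_scattered_subset G (d D : nat) :
  (forall j, #|S j| <= d)%N -> {in G, forall i, #|outputs i| <= D}%N ->
  exists I, [/\ I \subset G, scattered I & (#|G| <= #|I| * (D * d).+1)%N].
Proof.
move=> S_le G_le; pose P I := (I \subset G) && scattered I.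
have P0 : P set0 by rewrite /P sub0set; apply/scatteredP => j i; rewrite inE.
have [I /maxsetP[/andP[IG I_scat] I_max] _] := maxset_exists P0.
exists I; split=> //.
have GI : G \subset I :|: \bigcup_(i in I) neighbours i.
  apply/subsetP => i iG; rewrite inE; apply/orP.
  have [/bigcupP iN|iN] := boolP (i \in \bigcup_(k in I) neighbours k); [by right|left].
  have far k j : k \in I -> k \in S j -> i \in S j -> i = k.
    move=> kI kj ij; case/negP: iN; apply/bigcupP; exists k => //.
    by apply/bigcupP; exists j; rewrite ?inE.
  suff PiI : P (i |: I) by rewrite -(I_max _ PiI) ?setU11 // subsetUr.
  rewrite /P subUset sub1set iG IG; apply/scatteredP => j a b.
  rewrite !inE => /predU1P[->|aI] /predU1P[->|bI] aj bj //; first exact: far bj aj.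
    by symmetry; exact: far aj bj.
  exact: (scatteredP I I_scat) aj bj.
apply: leq_trans (subset_leq_card GI) _; apply: leq_trans (leq_card_setU _ _) _.
rewrite mulnS leq_add2l; apply: leq_trans (leq_card_bigcup _ _) _.
rewrite -sum_nat_const; apply: leq_sum => i iI; apply: leq_trans (leq_card_bigcup _ _) _.
apply: (@leq_trans (\sum_(j in outputs i) d)); first by apply: leq_sum => j _.
by rewrite sum_nat_const leq_mul2r G_le ?orbT // (subsetP IG).
Qed.

Lemma exists_scattered_low_degree F (d : nat) :
  (forall j, #|S j| <= d)%N -> (0 < d)%N ->
  exists I, [/\ [disjoint I & F], scattered I, {in I, forall i, #|outputs i| <= 4 * d}%N
    & (4 * #|T| <= #|J| + 4 * (#|F| + #|I| * (4 * d ^ 2).+1))%N].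
Proof.
move=> S_le d0; pose high := [set i | 4 * d < #|outputs i|]%N.
have high_le : (4 * #|high| <= #|J|)%N.
  rewrite -(leq_pmul2r d0) mulnAC; apply: leq_trans (card_gt_outputs_le _) _.
  by rewrite -sum_nat_const; apply: leq_sum => j _.
have low_le : {in ~: (high :|: F), forall i, #|outputs i| <= 4 * d}%N.
  by move=> i; rewrite !inE negb_or -leqNgt => /andP[].
have [I [IG I_scat I_ge]] := exists_scattered_subset S_le low_le.
exists I; split=> //.
- by rewrite disjoints_subset (subset_trans IG) // setCS subsetUr.
- by move=> i /(subsetP IG) /low_le.
have := cardsC (high :|: F); have := (leq_card_setU high F : (_ <= _)%N).
by move: I_ge high_le; rewrite -mulnA mulnn; lia.
Qed.

End Scattered.

(** * Local maps *)

Lemma leq_card_preimset (A B : finType) (g : A -> B) (D : {set B}) :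
  injective g -> (#|g @^-1: D| <= #|D|)%N.
Proof.
move=> g_inj; rewrite -(card_imset _ g_inj).
by apply/subset_leq_card/subsetP => _ /imsetP[x + ->]; rewrite inE.
Qed.

Lemma leq_card_fibers (A B : finType) (g : A -> B) (D : {set B}) (a : nat) :
  {in D, forall z, a <= #|g @^-1: [set z]|}%N -> (#|D| * a <= #|A|)%N.
Proof.
move=> fib_ge; have -> : (#|A| = \sum_z #|g @^-1: [set z]|)%N.
  rewrite -sum1_card (partition_big g predT) //=; apply: eq_bigr => z _.
  by rewrite -sum1dep_card; apply: eq_bigl => x; rewrite !inE.
rewrite (bigID (mem D)) /= -sum_nat_const; apply: leq_trans (leq_addr _ _).
exact: leq_sum.
Qed.

Lemma card_bits (k : nat) : #|{: bits k}| = (2 ^ k)%N.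
Proof. by rewrite card_bool_ffun card_ord. Qed.

Lemma hweight_sum (k : nat) (x : bits k) : hweight x = \sum_j (x j)%:R :> int.
Proof. by rewrite -natr_card natz. Qed.

Definition init_bits (k : nat) (z : bits k.+1) : bits k := [ffun j => z (lift ord_max j)].

Lemma init_snoc_bit (k : nat) (x : bits k) (b : bool) : init_bits (snoc_bit x b) = x.
Proof. by apply/ffunP => j; rewrite !ffunE liftK. Qed.

Lemma snoc_bit_last (k : nat) (x : bits k) (b : bool) : snoc_bit x b ord_max = b.
Proof. by rewrite ffunE unlift_none. Qed.

Lemma target_map_inj (p n : nat) : injective (target_map p (n := n)).
Proof. by move=> x y /(congr1 (@init_bits n)); rewrite !init_snoc_bit. Qed.

Section Flips.
Variable T : finType.
Implicit Types (A : {set T}) (u : {ffun T -> bool}).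

Definition flips A u : {ffun T -> bool} := [ffun j => u j (+) (j \in A)].

Lemma flipsK A : involutive (flips A).
Proof. by move=> u; apply/ffunP => j; rewrite !ffunE addbK. Qed.

Lemma flipsC A1 A2 u : flips A1 (flips A2 u) = flips A2 (flips A1 u).
Proof. by apply/ffunP => j; rewrite !ffunE addbAC. Qed.

Lemma flips_inj u : injective (flips^~ u).
Proof.
by move=> A1 A2 /ffunP eqA; apply/setP => j; have := eqA j; rewrite !ffunE => /addbI.
Qed.

End Flips.

Definition determined_by (l m : nat) (f : bits l -> bits m) (S : 'I_m -> {set 'I_l}) : Prop :=
  forall (j : 'I_m) (x y : bits l), {in S j, x =1 y} -> f x j = f y j.

Section LocalMap.
Variables (l n : nat) (f : bits l -> bits n.+1) (S : 'I_n.+1 -> {set 'I_l}) (I : {set 'I_l}).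
Hypotheses (f_S : determined_by f S) (I_last : [disjoint I & S ord_max]).
Hypothesis I_scat : scattered S I.
Implicit Types (i k : 'I_l) (u : bits l) (A : {set 'I_l}).

Definition flip i u : bits l := flips [set i] u.

Definition block i : {set 'I_n} := lift ord_max @^-1: outputs S i.

Definition output_weight u : int := hweight (init_bits (f u)).

Definition weight_increment : 'I_l -> bits l -> int := increment flip output_weight.

Definition active u : {set 'I_l} := [set i in I | weight_increment i u != 0].

Lemma flipK i : involutive (flip i).
Proof. exact: flipsK. Qed.

Lemma mem_block i (j : 'I_n) : (j \in block i) = (i \in S (lift ord_max j)).
Proof. by rewrite !inE. Qed.

Lemma card_block_le i : (#|block i| <= #|outputs S i|)%N.
Proof. exact: leq_card_preimset lift_inj. Qed.

Lemma block_disj : {in I &, forall i k, i != k -> [disjoint block i & block k]}.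
Proof.
move=> i k iI kI; apply: contraNT => /pred0Pn[j /=]; rewrite !mem_block => /andP[ij kj].
by apply/eqP; exact: (scatteredP S I I_scat) ij kj.
Qed.

Lemma flips_disjoint A u (j : 'I_n.+1) : [disjoint A & S j] -> f (flips A u) j = f u j.
Proof. by move=> disj; apply: f_S => i ij; rewrite ffunE (disjointFl disj) ?addbF. Qed.

Lemma flip_notin i u (j : 'I_n.+1) : i \notin S j -> f (flip i u) j = f u j.
Proof. by rewrite -disjoints1; exact: flips_disjoint. Qed.

Lemma flip_last i u : i \in I -> f (flip i u) ord_max = f u ord_max.
Proof. by move=> iI; rewrite flip_notin // (disjointFr I_last). Qed.

(* The bits of [A] meeting [S j], if any, reduce to a single one. *)
Lemma flips_scattered A u (j : 'I_n.+1) : A \subset I ->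
  (forall i, i \in A -> f (flip i u) j = f u j) -> f (flips A u) j = f u j.
Proof.
move=> /subsetP AI A_flip; have [/flips_disjoint//|] := boolP [disjoint A & S j].
move=> /pred0Pn[i /andP[/= iA ij]].
rewrite -(A_flip i iA); apply: f_S => k kj; rewrite !ffunE inE; congr (_ (+) _).
by apply/idP/eqP => [kA|->] //; exact: (scatteredP S I I_scat) (AI _ kA) (AI _ iA) kj ij.
Qed.

Lemma weight_incrementE i u :
  weight_increment i u = \sum_(j in block i)
    ((f (flip i u) (lift ord_max j))%:R - (f u (lift ord_max j))%:R).
Proof.
rewrite /weight_increment /increment /output_weight !hweight_sum -sumrB.
rewrite [RHS]big_mkcond; apply: eq_bigr => j _; rewrite mem_block !ffunE.
by case: ifPn => // ij; rewrite flip_notin ?subrr.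
Qed.

Lemma weight_increment_flip_neq i k u : i \in I -> k \in I -> i != k ->
  weight_increment k (flip i u) = weight_increment k u.
Proof.
move=> iI kI ik; rewrite !weight_incrementE; apply: eq_bigr => j; rewrite mem_block => kj.
have ij : i \notin S (lift ord_max j).
  by apply: contra ik => ij; apply/eqP; exact: (scatteredP S I I_scat) ij kj.
by rewrite [flip k _]flipsC !(flip_notin _ ij).
Qed.

Lemma weight_increment_flip i u : weight_increment i (flip i u) = - weight_increment i u.
Proof. by rewrite /weight_increment /increment flipK opprB. Qed.

Lemma active_flip i u : i \in I -> active (flip i u) = active u.
Proof.
move=> iI; apply/setP => k; rewrite !inE; apply: andb_id2l => kI.
have [->|ik] := eqVneq i k; first by rewrite weight_increment_flip oppr_eq0.
by rewrite weight_increment_flip_neq.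
Qed.

Lemma norm_weight_increment_le i u : (`|weight_increment i u| <= #|outputs S i|)%N.
Proof.
apply: leq_trans (card_block_le i); rewrite -lez_nat abszE weight_incrementE.
apply: le_trans (ler_norm_sum _ _ _) _; rewrite -sum1_card -natz natr_sum.
by apply: ler_sum => j _; case: (f _ _); case: (f _ _).
Qed.

Lemma vanishing_inactive_flip i u :
  i \in zero_blocks I block (init_bits (f u)) :\: active u -> f (flip i u) = f u.
Proof.
rewrite !inE negb_and negbK => /andP[+ /andP[iI /forall_inP block0]]; rewrite iI /= => /eqP.
have f0 j : j \in block i -> f u (lift ord_max j) = false.
  by move=> /block0; rewrite ffunE => /negPf.
rewrite weight_incrementE (eq_bigr (fun j => (f (flip i u) (lift ord_max j))%:R)); last first.
  by move=> j /f0 ->; rewrite subr0.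
move=> /eqP; rewrite psumr_eq0 // => /allP flip0.
apply/ffunP => j; case: (unliftP ord_max j) => [j' ->|->]; last exact: flip_last.
have [jb|] := boolP (j' \in block i); last by rewrite mem_block => /flip_notin.
by have := flip0 j' (mem_index_enum _); rewrite jb f0 //; case: (f _ _).
Qed.

Lemma card_fiber_ge u :
  (2 ^ #|zero_blocks I block (init_bits (f u)) :\: active u| <= #|f @^-1: [set f u]|)%N.
Proof.
set Z := _ :\: _; rewrite -card_powerset -(card_imset _ (@flips_inj _ u)).
apply/subset_leq_card/subsetP => _ /imsetP[A + ->]; rewrite !inE => /subsetP AZ.
have AI : A \subset I by apply/subsetP => i /AZ; rewrite !inE => /andP[_ /andP[]].
apply/eqP/ffunP => j; apply: flips_scattered AI _ => i /AZ iZ.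
by rewrite vanishing_inactive_flip.
Qed.

End LocalMap.

(** * The distinguisher *)

Definition off_target (p n : nat) (z : bits n.+1) : bool :=
  z ord_max != (majmod p (init_bits z) (+) parity (init_bits z)).

Lemma off_target_target_map (p n : nat) (x : bits n) : off_target p (target_map p x) = false.
Proof. by rewrite /off_target init_snoc_bit snoc_bit_last eqxx. Qed.

Section Distinguisher.
Variables (R : realType) (l n p N K : nat) (f : bits l -> bits n.+1).
Variables (S : 'I_n.+1 -> {set 'I_l}) (I : {set 'I_l}) (eta : R).
Hypotheses (f_S : determined_by f S) (I_last : [disjoint I & S ord_max]).
Hypotheses (I_scat : scattered S I) (I_deg : {in I, forall i, #|outputs S i| < p}%N).
Hypotheses (p_pr : prime p) (p_odd : odd p).
Hypotheses (eta_ge0 : 0 <= eta) (eta_p : shift_contraction R p ^+ N * p%:R <= eta ^+ 2).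
Implicit Types (u : bits l) (z : bits n.+1).

Definition mixing u : bool := (N <= #|active f I u|)%N.

Definition output_zero_blocks z : {set 'I_l} := zero_blocks I (block S) (init_bits z).

Definition frozen_outputs : {set bits n.+1} :=
  [set z | (K <= #|output_zero_blocks z|)%N && [exists u, ~~ mixing u && (f u == z)]].

Definition distinguisher : {set bits n.+1} :=
  [set z | [|| off_target p z, (#|output_zero_blocks z| < K)%N | z \in frozen_outputs]].

Lemma off_target_indicator u : (off_target p (f u))%:R =
  (1 - (-1) ^+ (f u ord_max) * twist (majmod_sign R p) (output_weight f u)) / 2 :> R.
Proof.
rewrite twist_majmod_sign // -signr_addb /off_target.
by case: (f u _); case: (_ (+) _) => /=; lra.
Qed.

Lemma norm_twist_avg_increments_le u : mixing u ->
  `|twist (avg_shifts (majmod_sign R p) [seq weight_increment f i u | i <- enum I])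
     (output_weight f u)| <= p%:R^-1 + eta.
Proof.
move=> u_mix; rewrite norm_twist.
have es_p : {in [seq weight_increment f i u | i <- enum I],
    forall e, e != 0 -> e%:~R != 0 :> 'F_p}.
  move=> _ /mapP[i + ->]; rewrite mem_enum => iI; apply: intr_Fp_neq0 => //.
  exact: leq_ltn_trans (norm_weight_increment_le f_S i u) (I_deg iI).
have N_le : (N <= count (predC1 0%R) [seq weight_increment f i u | i <- enum I])%N.
  apply: leq_trans u_mix _; rewrite count_map -size_filter cardE.
  rewrite uniq_leq_size ?enum_uniq // => i; rewrite mem_enum inE => /andP[iI ei].
  by rewrite mem_filter mem_enum iI andbT.
have sqr_sum : \sum_v majmod_sign R p v ^+ 2 = p%:R.
  by under eq_bigr do rewrite sqrr_sign; rewrite sumr_const card_Fp.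
apply: le_trans (norm_avg_shifts_le_mean p_pr p_odd _ es_p N_le eta_ge0 _) _; rewrite ?sqr_sum //.
by rewrite lerD2r ler_piMl ?invr_ge0 ?norm_sum_majmod_sign_le1.
Qed.

Lemma card_mixing_off_target_ge :
  #|[set u | mixing u]|%:R * ((1 - (p%:R^-1 + eta)) / 2)
    <= #|[set u | mixing u && off_target p (f u)]|%:R :> R.
Proof.
pose c u : R := (mixing u)%:R * (-1) ^+ (f u ord_max).
have indicator u : (mixing u && off_target p (f u))%:R =
    ((mixing u)%:R - c u * twist (majmod_sign R p) (output_weight f u)) / 2.
  by rewrite -mulnb natrM off_target_indicator /c; ring.
rewrite !natr_card (eq_bigr _ (fun u _ => indicator u)) -mulr_suml sumrB mulrA.
rewrite ler_pM2r ?invr_gt0 // mulrBr mulr1 lerD2l lerN2.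
rewrite (@sum_twist_avg_increments _ _ _ _ (@flip l) _ c _ _ (enum I)) ?enum_uniq //; first last.
- by move=> i k; rewrite !mem_enum => iI kI ik u; exact: (weight_increment_flip_neq f_S I_scat).
- move=> i; rewrite mem_enum => iI u.
  by rewrite /c /mixing (active_flip f_S I_scat) // (flip_last f_S I_last).
- exact: flipK.
rewrite mulr_suml; apply: ler_sum => u _; rewrite /c.
have [u_mix|_] := boolP (mixing u); last by rewrite !mul0r.
rewrite !mul1r; apply: le_trans (ler_norm _) _; rewrite normrM normr_sign mul1r.
exact: norm_twist_avg_increments_le.
Qed.

Lemma card_frozen_outputs_le : (#|frozen_outputs| * 2 ^ (K - N) <= 2 ^ l)%N.
Proof.
rewrite -[leqRHS]card_bits; apply: (leq_card_fibers (g := f)) => z.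
rewrite inE => /andP[Kz /existsP[u /andP[u_frozen /eqP fu]]].
rewrite -fu in Kz *; apply: leq_trans (card_fiber_ge f_S I_last I_scat u).
rewrite leq_exp2l // leq_subLR; apply: leq_trans Kz _.
rewrite -(cardsID (active f I u) (output_zero_blocks (f u))) leq_add2r.
by apply: leq_trans (subset_leq_card (subsetIr _ _)) _; rewrite ltnW // ltnNge.
Qed.

Lemma not_mixing_distinguisher u : ~~ mixing u -> f u \in distinguisher.
Proof.
move=> u_frozen; rewrite inE; case: leqP => /= [Ku|_]; last by rewrite orbT.
by rewrite inE Ku orbC; apply/orP; left; apply/existsP; exists u; rewrite u_frozen /=.
Qed.

Lemma push_prob_distinguisher_ge :
  (1 - (p%:R^-1 + eta)) / 2 <= push_prob R f distinguisher.
Proof.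
rewrite /push_prob ler_pdivlMr ?ltr0n ?card_bits ?expn_gt0 //.
have mix_ge := card_mixing_off_target_ge.
set a := _ / 2 in mix_ge *; set mix := [set u | mixing u] in mix_ge.
have p0 : 0 <= p%:R^-1 :> R by rewrite invr_ge0.
have a1 : a <= 1 by move: eta_ge0; rewrite /a; lra.
rewrite -card_bits -(cardsC mix) natrD mulrDr mulrC.
have frozen_le : a * #|~: mix|%:R <= #|~: mix|%:R by rewrite ler_piMl.
apply: le_trans (lerD mix_ge frozen_le) _; rewrite !natr_card -big_split; apply: ler_sum => u _ /=.
rewrite inE; case: (boolP (mixing u)) => [_|/not_mixing_distinguisher ->] /=; last by rewrite add0r.
by rewrite addr0 ler_nat inE; case: off_target.
Qed.

Lemma push_prob_target_distinguisher_le :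
  (0 < K)%N -> K.*2%:R <= mean_zero_blocks R I (block S) ->
  push_prob R (target_map p (n := n)) distinguisher <=
    2 / K%:R + 2 ^+ l / 2 ^+ (K - N) / 2 ^+ n.
Proof.
move=> K0 KE; rewrite /push_prob card_bits natrX.
rewrite ler_pdivrMr ?exprn_gt0 // mulrDl divfK ?expf_neq0 ?pnatr_eq0 //.
pose few := [set x | #|zero_blocks I (block S) x| < K]%N.
pose frozen := target_map p (n := n) @^-1: frozen_outputs.
apply: (@le_trans _ _ (#|few| + #|frozen|)%N%:R).
  rewrite ler_nat; apply: leq_trans (leq_card_setU _ _); apply/subset_leq_card/subsetP => x.
  rewrite inE in_setU [x \in few]inE [x \in frozen]inE [_ \in distinguisher]inE.
  by rewrite off_target_target_map /output_zero_blocks init_snoc_bit.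
rewrite natrD; apply: lerD.
  by have := card_few_zero_blocks_le (block_disj I_scat) K0 KE; rewrite card_ord mulrC.
rewrite ler_pdivlMr ?exprn_gt0 // -!natrX -natrM ler_nat.
apply: leq_trans card_frozen_outputs_le; rewrite leq_mul2r orbC leq_card_preimset //.
exact: target_map_inj.
Qed.

End Distinguisher.

Lemma tv_push_ge (R : realType) (A1 A2 B : finType) (g1 : A1 -> B) (g2 : A2 -> B) (D : {set B}) :
  push_prob R g1 D - push_prob R g2 D <= tv_push R g1 g2.
Proof.
apply: le_trans (ler_norm _) _.
exact: (le_bigmax _ (fun D => `|push_prob R g1 D - push_prob R g2 D|)).
Qed.

Lemma tv_push_injective_ge (R : realType) (A1 A2 B : finType) (g1 : A1 -> B) (g2 : A2 -> B) :
  injective g2 -> (0 < #|A1|)%N -> 1 - #|A1|%:R / #|A2|%:R <= tv_push R g1 g2.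
Proof.
move=> g2_inj A1_gt0; apply: le_trans (tv_push_ge R g1 g2 [set g1 u | u in [set: A1]]).
have -> : push_prob R g1 [set g1 u | u in [set: A1]] = 1.
  rewrite /push_prob (_ : [set a | _] = setT) ?cardsT ?divff ?pnatr_eq0 -?lt0n //.
  by apply/setP => u; rewrite !inE imset_f.
rewrite lerD2l lerN2 ler_wpM2r ?invr_ge0 // ler_nat.
apply: leq_trans (leq_card_preimset _ g2_inj) _.
by rewrite -cardsT leq_imset_card.
Qed.

Lemma tv_push_short_seed (R : realType) (l n p : nat) (f : bits l -> bits n.+1) :
  (l < n)%N -> 1 / 2 <= tv_push R f (target_map p (n := n)).
Proof.
move=> ln; apply: le_trans (tv_push_injective_ge R f (@target_map_inj p n) _); last first.
  by rewrite card_bits expn_gt0.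
rewrite !card_bits lerBrDr -lerBrDl ler_pdivrMr ?ltr0n ?expn_gt0 //.
have : (2 * 2 ^ l <= 2 ^ n)%N by rewrite -expnS leq_exp2l.
by rewrite -(ler_nat R) natrM; lra.
Qed.

(* Each of the disjoint blocks of the [I] inputs vanishes with probability at least [2 ^- 4d]. *)
Lemma tv_push_local_ge (R : realType) (l n d p N K : nat) (f : bits l -> bits n.+1)
    (S : 'I_n.+1 -> {set 'I_l}) (eta : R) :
  determined_by f S -> (forall j, #|S j| <= d)%N -> (0 < d)%N -> prime p -> (4 * d < p)%N ->
  0 <= eta -> shift_contraction R p ^+ N * p%:R <= eta ^+ 2 ->
  (0 < K)%N -> (n <= l)%N -> (4 * K * 2 ^ (4 * d) * (4 * d ^ 2 + 1) <= n)%N ->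
  (1 - (p%:R^-1 + eta)) / 2 - (2 / K%:R + 2 ^+ l / 2 ^+ (K - N) / 2 ^+ n)
    <= tv_push R f (target_map p (n := n)).
Proof.
move=> f_S S_le d0 p_pr dp eta0 eta_p K0 nl nK.
have p_odd : odd p by case: (even_prime p_pr) => // p2; lia.
have [I [I_last I_scat I_deg I_card]] := exists_scattered_low_degree (S ord_max) S_le d0.
have I_ge : (K.*2 * 2 ^ (4 * d) <= #|I|)%N.
  have e4d : (4 * d < 2 ^ (4 * d))%N by apply: ltn_expl.
  move: nK I_card (S_le ord_max) e4d; rewrite !card_ord.
  by move: (2 ^ (4 * d))%N (4 * d ^ 2)%N => a b; rewrite -muln2; nia.
have mean_ge : K.*2%:R <= mean_zero_blocks R I (block S).
  apply: (@le_trans _ _ (#|I|%:R * 2 ^- (4 * d))).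
    by rewrite ler_pdivlMr ?exprn_gt0 // -natrX -natrM ler_nat.
  rewrite mulr_natl -sumr_const; apply: ler_sum => i iI.
  rewrite lef_pV2 ?posrE ?exprn_gt0 // ler_weXn2l ?ler1n //.
  exact: leq_trans (card_block_le S i) (I_deg i iI).
apply: le_trans (tv_push_ge R f _ (distinguisher p N K f S I)).
apply: lerB; last exact: push_prob_target_distinguisher_le.
apply: push_prob_distinguisher_ge => // i iI.
exact: leq_ltn_trans (I_deg i iI) dp.
Qed.

(** * Choice of the parameters *)

Lemma exists_exponents_lt1 (R : realFieldType) (a b : R) : a < 1 -> b < 1 ->
  exists theta eps : R, [/\ 0 < eps, a <= theta, b <= theta & theta + 4 * eps < 1].
Proof.
move=> a1 b1; pose theta := Num.max a b; have theta1 : theta < 1 by rewrite gt_max a1.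
by exists theta, ((1 - theta) / 8); rewrite !le_max !lexx orbT; split=> //; lra.
Qed.

Lemma near_poly_le_expR (R : realType) (C g : R) (k : nat) : 0 < g ->
  \forall L \near +oo, C * L ^+ k <= expR (g * L).
Proof.
move=> g0; pose a := g ^+ k.+1 / k.+1`!%:R.
have a0 : 0 < a by rewrite divr_gt0 ?exprn_gt0 // ltr0n fact_gt0.
near=> L; have L0 : 0 <= L by near: L; exact: nbhs_pinfty_ge.
have L_ge : C / a <= L by near: L; apply: nbhs_pinfty_ge; exact: num_real.
have gL0 : 0 <= g * L by rewrite mulr_ge0 // ltW.
apply: (@le_trans _ _ ((g * L) ^+ k.+1 / k.+1`!%:R)).
  rewrite exprMn mulrAC -/a exprS mulrA ler_wpM2r ?exprn_ge0 //.
  by rewrite mulrC -ler_pdivrMr.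
by apply: le_trans (expR_ge1Dxn k gL0); rewrite lerDr.
Unshelve. all: by end_near. Qed.

Lemma eventually_ln_nat (R : realType) (P : R -> Prop) : (\forall L \near +oo, P L) ->
  exists n0, forall n, (n0 <= n)%N -> 0 < n%:R :> R /\ P (ln n%:R).
Proof.
move=> [A [_ PA]]; exists (Num.truncn (expR A)).+1 => n n_ge.
have n_gt : expR A < n%:R by apply: lt_le_trans (truncnS_gt _) _; rewrite ler_nat.
have n_gt0 : 0 < n%:R :> R := lt_trans (expR_gt0 A) n_gt.
by split=> //; apply: PA; rewrite -ltr_expR lnK.
Qed.

Definition nat_above (R : realType) (x : R) : nat := (Num.truncn x).+1.

Lemma nat_above_ge (R : realType) (x : R) : x <= (nat_above x)%:R.
Proof. exact: ltW (truncnS_gt x). Qed.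

Lemma nat_above_le (R : realType) (x : R) : 0 <= x -> (nat_above x)%:R <= x + 1.
Proof. by move=> x0; rewrite -natr1 lerD2r truncn_le. Qed.

Lemma is_local_determined (R : realType) (l m : nat) (d : R) (f : bits l -> bits m) :
  is_local d f -> exists2 S, determined_by f S & forall j, (#|S j| <= nat_above d)%N.
Proof.
move=> /fin_all_exists[S S_loc]; exists S => j; first exact: (S_loc j).2.
by rewrite -(ler_nat R) (le_trans (S_loc j).1) // nat_above_ge.
Qed.

Definition mixing_threshold (R : realType) (p : nat) (L : R) : nat :=
  nat_above (6 * p%:R ^+ 2 * L).

(* [M] bounds the excess [l - n]: with [N] the mixing threshold, frozen outputs have at least
   [2 ^ (M + L)] preimages. *)
Definition vanishing_threshold (R : realType) (p M : nat) (L : R) : nat :=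
  mixing_threshold p L + (M + nat_above L).

Definition required_length (R : realType) (p d M : nat) (L : R) : nat :=
  4 * vanishing_threshold p M L * 2 ^ (4 * d) * (4 * d ^ 2 + 1).

Lemma shift_contraction_exp_le (R : realType) (p N : nat) : prime p ->
  shift_contraction R p ^+ N <= expR (- (N%:R / (2 * p%:R ^+ 2))).
Proof.
move=> p_pr; rewrite -mulrN expRM_natl.
rewrite lerXn2r ?nnegrE ?shift_contraction_ge0 ?expR_ge0 //.
exact: expR_ge1Dx.
Qed.

Lemma shift_contraction_mixing_threshold_le (R : realType) (p : nat) (L : R) :
  prime p -> 1 <= L -> p%:R <= expR L ->
  shift_contraction R p ^+ mixing_threshold p L * p%:R <= L^-1 ^+ 2.
Proof.
move=> p_pr L1 pL; have p0 : 0 < 2 * p%:R ^+ 2 :> R.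
  by rewrite mulr_gt0 // exprn_gt0 // ltr0n prime_gt0.
have decay : shift_contraction R p ^+ mixing_threshold p L <= expR (- L *+ 3).
  apply: le_trans (shift_contraction_exp_le _ _ p_pr) _.
  rewrite ler_expR mulNrn lerN2 ler_pdivlMr //.
  by apply: le_trans (nat_above_ge _); lra.
apply: (@le_trans _ _ (expR (- L *+ 3) * expR L)).
  by apply: ler_pM => //; rewrite exprn_ge0 // shift_contraction_ge0.
rewrite -expRD mulrSr subrK -mulr_natr expRM_natr expRN.
rewrite lerXn2r ?nnegrE ?invr_ge0 ?expR_ge0 // ?lef_pV2 ?posrE ?expR_gt0 //; try lra.
by apply: le_trans (expR_ge1Dx _); rewrite lerDr.
Qed.

Lemma seed_excess_le (R : realType) (l n M Q : nat) (L : R) : 0 < L ->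
  (l <= n + M)%N -> L <= Q%:R -> 2 ^+ l / 2 ^+ (M + Q) / 2 ^+ n <= L^-1.
Proof.
move=> L0 lnM LQ; have Q_ge : L <= 2 ^+ Q.
  by apply: le_trans LQ _; rewrite -natrX ler_nat ltnW // ltn_expl.
rewrite -mulrA -invfM -exprD ler_pdivrMr ?exprn_gt0 // ler_pdivlMl //.
have -> : (M + Q + n = n + M + Q)%N by lia.
rewrite exprD mulrC; apply: ler_pM; rewrite ?exprn_ge0 ?(ltW L0) //.
by rewrite ler_weXn2l ?ler1n.
Qed.

Lemma tv_push_local_log_ge (R : realType) (l n d p M : nat) (f : bits l -> bits n.+1)
    (S : 'I_n.+1 -> {set 'I_l}) (L : R) :
  determined_by f S -> (forall j, #|S j| <= d)%N -> (0 < d)%N -> prime p -> (4 * d < p)%N ->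
  1 <= L -> L <= p%:R -> p%:R <= expR L -> (n <= l)%N -> (l <= n + M)%N ->
  (required_length p d M L <= n)%N ->
  1 / 2 - 4 / L <= tv_push R f (target_map p (n := n)).
Proof.
move=> f_S S_le d0 p_pr dp L1 Lp pL nl lnM nK; have L0 : 0 < L by lra.
set K := vanishing_threshold p M L; have LK : L <= K%:R.
  by apply: le_trans (nat_above_ge L) _; rewrite ler_nat /K /vanishing_threshold addnA leq_addl.
have K0 : (0 < K)%N by rewrite -(ltr_nat R) (lt_le_trans L0).
have Linv : 0 <= L^-1 by rewrite invr_ge0 ltW.
have decay := shift_contraction_mixing_threshold_le p_pr L1 pL.
apply: le_trans (tv_push_local_ge f_S S_le d0 p_pr dp Linv decay K0 nl nK).
have p_inv : p%:R^-1 <= L^-1 by rewrite lef_pV2 ?posrE ?(lt_le_trans L0).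
have K_inv : K%:R^-1 <= L^-1 by rewrite lef_pV2 ?posrE ?(lt_le_trans L0).
have := seed_excess_le L0 lnM (nat_above_ge L); rewrite addKn => excess.
by move: (2 ^+ l / _ / _) (K%:R^-1) (p%:R^-1) (L^-1) p_inv K_inv excess => *; lra.
Qed.

Lemma pow2_mul_nat_above_le (R : realType) (k : nat) (x : R) : 0 <= x ->
  2 ^+ (k * nat_above x) <= expR (k%:R * (x + 1)).
Proof.
move=> x0; apply: (@le_trans _ _ (expR 1 ^+ (k * nat_above x))).
  by rewrite lerXn2r ?nnegrE ?expR_ge0 //; apply: le_trans (expR_ge1Dx _).
by rewrite -expRM_natl mulr1 ler_expR natrM ler_wpM2l // nat_above_le.
Qed.

Lemma sqr_nat_above_scale_le (R : realType) (eps L : R) : 0 <= eps -> 1 <= L ->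
  4 * (nat_above (eps * L))%:R ^+ 2 + 1 <= (4 * (eps + 1) ^+ 2 + 1) * L ^+ 2.
Proof.
move=> eps0 L1; have L0 : 0 <= L by lra.
have above_le : (nat_above (eps * L))%:R <= (eps + 1) * L.
  by apply: le_trans (nat_above_le (mulr_ge0 eps0 L0)) _; lra.
have sqr_le : (nat_above (eps * L))%:R ^+ 2 <= ((eps + 1) * L) ^+ 2.
  by rewrite lerXn2r ?nnegrE // mulr_ge0 // addr_ge0.
have : 1 <= L ^+ 2 by rewrite exprn_ege1.
by move: sqr_le; rewrite exprMn; lra.
Qed.

Lemma vanishing_threshold_le (R : realType) (c alpha delta theta L : R) (p : nat) :
  1 <= L -> 0 <= theta -> 2 * alpha <= theta -> delta <= theta ->
  p%:R <= c * expR (alpha * L) ->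
  (vanishing_threshold p (nat_above (expR (delta * L))) L)%:R
    <= (6 * c ^+ 2 + 5) * L * expR (theta * L).
Proof.
move=> L1 theta0 alpha_theta delta_theta p_le; have L0 : 0 <= L by lra.
set E := expR (theta * L).
have p2_le : p%:R ^+ 2 <= c ^+ 2 * E.
  apply: (@le_trans _ _ ((c * expR (alpha * L)) ^+ 2)).
    by rewrite lerXn2r ?nnegrE // (le_trans _ p_le).
  by rewrite exprMn ler_wpM2l ?sqr_ge0 // -expRM_natl ler_expR mulrA ler_wpM2r.
have p2L_le := ler_wpM2r L0 p2_le.
have p2L_ge0 : 0 <= 6 * p%:R ^+ 2 * L by rewrite !mulr_ge0 ?sqr_ge0.
have mixing_le : (mixing_threshold p L)%:R <= _ := nat_above_le p2L_ge0.
have delta_le := nat_above_le (expR_ge0 (delta * L)).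
have L_le := nat_above_le L0.
have delta_E : expR (delta * L) <= E by rewrite ler_expR ler_wpM2r.
have E1 : 1 <= E by rewrite -expR0 ler_expR mulr_ge0.
have LE : L <= L * E by rewrite ler_peMr.
have EL : E <= L * E by rewrite ler_peMl // expR_ge0.
have -> : (6 * c ^+ 2 + 5) * L * E = 6 * (c ^+ 2 * E * L) + 5 * (L * E) by ring.
by rewrite !natrD; lra.
Qed.

Lemma near_required_length_le_expR (R : realType) (c alpha delta theta eps : R) :
  0 <= eps -> 0 <= theta -> 2 * alpha <= theta -> delta <= theta -> theta + 4 * eps < 1 ->
  \forall L \near +oo, forall p : nat, p%:R <= c * expR (alpha * L) ->
  (required_length p (nat_above (eps * L)) (nat_above (expR (delta * L))) L)%:R <= expR L.
Proof.
move=> eps0 theta0 alpha_theta delta_theta theta_eps.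
pose c_vanishing := 6 * c ^+ 2 + 5; pose c_sqr := 4 * (eps + 1) ^+ 2 + 1.
have gap : 0 < 1 - theta - 4 * eps by lra.
near=> L => p p_le.
have L1 : 1 <= L by near: L; exact: nbhs_pinfty_ge.
have growth : 4 * c_vanishing * expR 4 * c_sqr * L ^+ 3 <= expR ((1 - theta - 4 * eps) * L).
  by near: L; exact: near_poly_le_expR.
have vanishing_le := vanishing_threshold_le L1 theta0 alpha_theta delta_theta p_le.
have pow_le := pow2_mul_nat_above_le 4 (mulr_ge0 eps0 (le_trans ler01 L1)).
have sqr_le := sqr_nat_above_scale_le eps0 L1.
rewrite natrM [X in _ * X]natrD !natrM !natrX.
apply: (@le_trans _ _ (4 * (c_vanishing * L * expR (theta * L)) *
    expR (4 * (eps * L + 1)) * (c_sqr * L ^+ 2))).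
  by do 3?[apply: ler_pM => //]; rewrite ?mulr_ge0 ?addr_ge0 ?mulr_ge0 ?exprn_ge0.
have -> : 4 * (eps * L + 1) = 4 * eps * L + 4 by ring.
have -> : expR L = expR ((1 - theta - 4 * eps) * L) * (expR (theta * L) * expR (4 * eps * L)).
  by rewrite -!expRD; congr expR; ring.
have E0 : 0 <= expR (theta * L) * expR (4 * eps * L) by rewrite mulr_ge0 ?expR_ge0.
by rewrite expRD; have := ler_wpM2r E0 growth; lra.
Unshelve. all: by end_near. Qed.

Lemma near_parameters_admissible (R : realType) (c1 c2 alpha delta theta eps : R) :
  0 < c1 -> 0 < alpha -> alpha < 1 ->
  0 <= eps -> 0 <= theta -> 2 * alpha <= theta -> delta <= theta -> theta + 4 * eps < 1 ->
  \forall L \near +oo, 1 <= L /\ forall p : nat,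
    c1 * expR (alpha * L) <= p%:R -> p%:R <= c2 * expR (alpha * L) ->
    [/\ (4 * nat_above (eps * L) < p)%N, L <= p%:R, p%:R <= expR L &
      (required_length p (nat_above (eps * L)) (nat_above (expR (delta * L))) L)%:R <= expR L].
Proof.
move=> c10 alpha0 alpha1 eps0 theta0 alpha_theta delta_theta theta_eps.
near=> L; have L1 : 1 <= L by near: L; exact: nbhs_pinfty_ge.
split=> // p p_ge p_le.
have p_ge_L : (4 * eps + 5) * L <= p%:R.
  apply: le_trans p_ge; rewrite -ler_pdivrMl // mulrA -[X in _ * X]expr1.
  by near: L; exact: near_poly_le_expR.
have epsL0 : 0 <= eps * L by rewrite mulr_ge0 //; lra.
have d_le := nat_above_le epsL0.
split.
- by rewrite -(ltr_nat R) natrM; lra.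
- by lra.
- have growth : c2 * L ^+ 0 <= expR ((1 - alpha) * L).
    by near: L; apply: near_poly_le_expR; rewrite subr_gt0.
  have -> : expR L = expR ((1 - alpha) * L) * expR (alpha * L).
    by rewrite -expRD; congr expR; ring.
  by rewrite mulr1 in growth; rewrite (le_trans p_le) // ler_wpM2r ?expR_ge0.
- move: p p_le {p_ge p_ge_L}; near: L.
  exact: (@near_required_length_le_expR _ _ _ _ theta).
Unshelve. all: by end_near. Qed.

Theorem theorem5p1 (R : realType) (delta alpha : R) :
  0 <= delta -> delta < 1 -> delta / 3 < alpha -> alpha < 1 / 3 ->
  exists eps : R, 0 < eps /\
  forall c1 c2 : R, 0 < c1 -> c1 <= c2 ->
  exists C : R, 0 < C /\ exists n0 : nat,
  forall n : nat, (n0 <= n)%N ->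
  forall p : nat, prime p ->
    c1 * (n%:R `^ alpha) <= p%:R -> p%:R <= c2 * (n%:R `^ alpha) ->
  forall l : nat, l%:R <= n%:R + n%:R `^ delta ->
  forall f : bits l -> bits n.+1,
    is_local (eps * ln (n%:R : R)) f ->
    1 / 2 - C / ln (n%:R : R) <= tv_push R f (target_map p (n:=n)).
Proof.
move=> delta0 delta1 delta_alpha alpha13.
have [alpha0 alpha1 alpha2] : [/\ 0 < alpha, alpha < 1 & 2 * alpha < 1] by split; lra.
have [theta [eps [eps0 alpha_theta delta_theta theta_eps]]] := exists_exponents_lt1 alpha2 delta1.
exists eps; split=> // c1 c2 c10 _; exists 4; split=> //.
have /eventually_ln_nat[n0 n0P] := near_parameters_admissible c2 c10 alpha0 alpha1 (ltW eps0)
  (le_trans delta0 delta_theta) alpha_theta delta_theta theta_eps.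
exists n0 => n /n0P[n_gt0 [L1 admissible]] p p_pr p_ge p_le l l_le f f_loc.
have powE (a : R) : n%:R `^ a = expR (a * ln n%:R) by rewrite /powR gt_eqF.
rewrite !powE in p_ge p_le l_le; have := admissible p p_ge p_le.
rewrite lnK ?posrE // !ler_nat => -[dp Lp pn length_le].
have [ln_lt|nl] := ltnP l n.
  apply: le_trans (tv_push_short_seed R p f ln_lt).
  by rewrite gerBl divr_ge0 // (le_trans ler01).
have [S f_S S_le] := is_local_determined f_loc.
apply: tv_push_local_log_ge f_S S_le _ p_pr dp L1 Lp _ nl _ length_le => //.
  by rewrite lnK // ler_nat.
by rewrite -(ler_nat R) natrD; apply: le_trans l_le _; rewrite lerD2l nat_above_ge.
Qed.
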